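(* Let $(x_n,y_n,z_n)$, $n=1,2,3,4$, be the known positions of four pinching antennas, and let $\mathbf X=[x_u,y_u,z_u]^T$ be the unknown user position. Put $\mathbf v_n=[x_u-x_n,\,y_u-y_n,\,z_u-z_n]^T$ and $d_{n1}=\|\mathbf v_n\|_2$. For a ranging algorithm $\mathcal A\in\{\mathrm{MP},\mathrm{R1}\}$ (matrix pencil or Rank-1), let the estimated line-of-sight distances be modeled as $\hat{\mathbf d}_{\mathcal A}=\mathbf d(\mathbf X)+\mathbf e_{\mathcal A}$, where $\hat{\mathbf d}_{\mathcal A}=[\hat d_{11}^{\mathcal A},\hat d_{21}^{\mathcal A},\hat d_{31}^{\mathcal A},\hat d_{41}^{\mathcal A}]^T$, $\mathbf d(\mathbf X)=[d_{11},d_{21},d_{31},d_{41}]^T$, and, under the high-SNR approximation, $\mathbf e_{\mathcal A}\sim\mathcal N(\mathbf 0,\mathbf C_{\mathcal A})$ with $\mathbf C_{\mathcal A}=\mathrm{diag}(V_{\mathcal A,1},V_{\mathcal A,2},V_{\mathcal A,3},V_{\mathcal A,4})$. Here $V_{\mathcal A,n}$ is the ranging variance of algorithm $\mathcal A$ at the $n$-th antenna, as given in the context. Then the log-likelihood function of $\hat{\mathbf d}_{\mathcal A}$ is $$\ln p(\hat{\mathbf d}_{\mathcal A};\mathbf X)=\mathrm{const}-\tfrac12\big(\hat{\mathbf d}_{\mathcal A}-\mathbf d(\mathbf X)\big)^T\mathbf C_{\mathcal A}^{-1}\big(\hat{\mathbf d}_{\mathcal A}-\mathbf d(\mathbf X)\big),$$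 the Fisher information matrix for the user position is $$\mathbf I_{\mathcal A}(\mathbf X)=\Big(\frac{\partial\mathbf d(\mathbf X)}{\partial\mathbf X}\Big)^T\mathbf C_{\mathcal A}^{-1}\Big(\frac{\partial\mathbf d(\mathbf X)}{\partial\mathbf X}\Big)=\sum_{n=1}^{4}\frac{1}{V_{\mathcal A,n}\,d_{n1}^2}\,\mathbf v_n\mathbf v_n^T,$$ the covariance matrix of any unbiased position estimator $\hat{\mathbf X}$ satisfies $\mathrm{Cov}(\hat{\mathbf X})\ge\mathbf I_{\mathcal A}^{-1}(\mathbf X)$, and the position error bound is $$\mathrm{PEB}_{\mathcal A}=\sqrt{\mathrm{tr}\big(\mathbf I_{\mathcal A}^{-1}(\mathbf X)\big)}.$$ The bounds for the matrix pencil and Rank-1 ranging algorithms are obtained by taking $\mathbf C_{\mathcal A}=\mathbf C_{\mathrm{MP}}$ and $\mathbf C_{\mathcal A}=\mathbf C_{\mathrm{R1}}$, respectively.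
   Context: Setting: a user transmits $I$ pilot symbols with transmit power $P$ over $K$ subcarriers with spacing $\Delta f$. The signal reaches the $n$-th pinching antenna and then travels along a waveguide to an access point at $(0,0,D_z)$. Both ranging algorithms build Hankel matrices from the channel observations averaged over the pilots, with pencil parameter $M$ and $G=K-M$, and estimate the line-of-sight distance $d_{n1}$ from the phase of the estimated line-of-sight pole $z_{n1}=e^{-j2\pi\Delta f\,d_{n1}/c}$, where $c$ is the speed of light. The ranging variances, derived under high-SNR approximations, are $$V_{\mathrm{MP},n}\approx\Big(\frac{c}{2\pi\Delta f}\Big)^2\frac{\sigma_w^2}{|\beta_{n1}|^2}\,\mathcal F_{\mathrm{MP}}(M,K),\qquad \mathcal F_{\mathrm{MP}}(M,K)=\begin{cases}\dfrac{1}{(K-M)^2M}, & M\le K/2,\\[1ex]\dfrac{1}{(K-M)M^2}, & M\ge K/2,\end{cases}$$ (for $\mathrm{MP}$, in a line-of-sight-dominant scenario) and $$V_{\mathrm{R1},n}=\Big(\frac{c}{2\pi\Delta f}\Big)^2\frac{\min(M+1,G-1)}{(M+1)^2(G-1)^2}\,\frac{\sigma_w^2}{|\beta_{n1}|^2}.$$ Here $\beta_{n1}=\alpha_{n1}e^{-j2\pi f_0 d_{n1}/c}$ is the complex line-of-sight amplitude, with $f_0$ the carrier frequency, $\alpha_{n1}=\lambda/(4\pi d_{n1})$ and $\lambda$ the wavelength. The noise variance after averaging is $\sigma_w^2=\sigma^2/(IP|h_{w,n}|^2)$, where $\sigma^2$ is the receiver noise variance, $h_{w,n}=\exp\big(-\tfrac{2\pi\sqrt{\varepsilon_r}}{\lambda}(\tfrac{\tan\delta}{2}+j)d_{An}\big)$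 is the waveguide channel with relative permittivity $\varepsilon_r$ and loss tangent $\tan\delta$, and $d_{An}=\sqrt{x_n^2+y_n^2+(z_n-D_z)^2}$ is the distance from the $n$-th antenna to the access point. *)

(* Defs.v *)
From HB Require Import structures.
From mathcomp Require Import all_boot all_order all_algebra.
From mathcomp Require Import all_classical all_reals all_analysis.
From mathcomp Require Import complex.

Set Implicit Arguments.
Unset Strict Implicit.
Unset Printing Implicit Defensive.

Import Order.TTheory GRing.Theory Num.Theory.
Import numFieldNormedType.Exports.

Local Open Scope classical_set_scope.
Local Open Scope complex_scope.
Local Open Scope ring_scope.

Section geometry.
Context {R : realType}.

(* Euclidean norm; the norm `|v| of the matrix library is the sup norm. *)
Definition norm2 n (v : 'cV[R]_n) : R := Num.sqrt (\sum_i v i 0 ^+ 2).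

Definition displacement (a : 'I_4 -> 'cV[R]_3) (X : 'cV[R]_3) (n : 'I_4) :
  'cV[R]_3 := X - a n.

Definition distances (a : 'I_4 -> 'cV[R]_3) (X : 'cV[R]_3) : 'cV[R]_4 :=
  \col_n norm2 (displacement a X n).

(* [partials f X] has entry (n, i) equal to the partial derivative of the n-th
   component of f with respect to the i-th coordinate. *)
Definition partials m k (f : 'cV[R]_k.+1 -> 'cV[R]_m) (X : 'cV[R]_k.+1) :
  'M[R]_(m, k.+1) :=
  \matrix_(n < m, i < k.+1) 'D_(delta_mx i 0) (fun t => f t n 0) X.

Definition loewner_le n (A B : 'M[R]_n) : Prop :=
  forall u : 'cV[R]_n, (u^T *m A *m u) 0 0 <= (u^T *m B *m u) 0 0.

End geometry.

Section ranging.
Context {R : realType}.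

Local Notation normc := ComplexField.Normc.normc.

Definition cexp (z : R[i]) : R[i] :=
  let: x +i* y := z in (expR x * cos y) +i* (expR x * sin y).

Record system := System {
  light_speed : R;
  spacing : R;               (* subcarrier spacing, Delta f *)
  carrier : R;               (* carrier frequency, f_0 *)
  wavelength : R;
  noise : R;                 (* variance sigma^2 at the receiver *)
  npilots : nat;             (* I *)
  power : R;                 (* P *)
  nsubcarriers : nat;        (* K *)
  pencil : nat;              (* M *)
  permittivity : R;          (* epsilon_r *)
  loss_tangent : R;          (* tan delta *)
  ap_height : R }.           (* D_z *)

Definition physical (s : system) : Prop :=
  [/\ 0 < light_speed s, 0 < spacing s & 0 < wavelength s] /\
  [/\ 0 < noise s, (0 < npilots s)%N & 0 < power s].

Definition access_point (s : system) : 'cV[R]_3 :=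
  \col_(i < 3) if i == ord_max then ap_height s else 0.

Definition waveguide (s : system) (an : 'cV[R]_3) : R[i] :=
  cexp (- ((2 * pi * Num.sqrt (permittivity s) / wavelength s)%:C
           * (loss_tangent s / 2 +i* 1)
           * (norm2 (an - access_point s))%:C)).

Definition avg_noise (s : system) (an : 'cV[R]_3) : R :=
  noise s / ((npilots s)%:R * power s * normc (waveguide s an) ^+ 2).

(* complex line-of-sight amplitude at distance r *)
Definition los_amplitude (s : system) (r : R) : R[i] :=
  (wavelength s / (4 * pi * r))%:C
  * cexp (0 -i* (2 * pi * carrier s * r / light_speed s)).

Inductive algorithm := MP | R1.

(* The two branches of the matrix-pencil factor agree when 2 M = K. *)
Definition ranging_factor (A : algorithm) (s : system) : R :=
  let K : R := (nsubcarriers s)%:R in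
  let M : R := (pencil s)%:R in
  let G := K - M in
  match A with
  | MP => if (2 * pencil s <= nsubcarriers s)%N
          then 1 / ((K - M) ^+ 2 * M) else 1 / ((K - M) * M ^+ 2)
  | R1 => Num.min (M + 1) (G - 1) / ((M + 1) ^+ 2 * (G - 1) ^+ 2)
  end.

(* Values of M for which no denominator of [ranging_factor] vanishes and the
   Hankel matrices have positive sizes. *)
Definition admissible (A : algorithm) (s : system) : Prop :=
  match A with
  | MP => (0 < pencil s < nsubcarriers s)%N
  | R1 => (pencil s + 1 < nsubcarriers s)%N
  end.

Definition ranging_variance (A : algorithm) (s : system)
    (a : 'I_4 -> 'cV[R]_3) (X : 'cV[R]_3) (n : 'I_4) : R :=
  (light_speed s / (2 * pi * spacing s)) ^+ 2
  * (avg_noise s (a n)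
     / normc (los_amplitude s (norm2 (displacement a X n))) ^+ 2)
  * ranging_factor A s.

(* It depends on X through the line-of-sight amplitudes.  In the statistical
   model it is a known matrix, evaluated at the true position and kept fixed while
   the position parameter of the likelihood varies. *)
Definition ranging_covariance (A : algorithm) (s : system)
    (a : 'I_4 -> 'cV[R]_3) (X : 'cV[R]_3) : 'M[R]_4 :=
  diag_mx (\row_n ranging_variance A s a X n).

End ranging.
Arguments system R : clear implicits.

Section statistics.
Context {R : realType}.

(* The measurable space R^4, with its Lebesgue measure, as an iterated product;
   [vec4] and [unvec4] are the mutually inverse identifications with column
   vectors. *)
Definition space4 : measurableType _ :=
  (measurableTypeR R * measurableTypeR R * measurableTypeR R
    * measurableTypeR R)%type.

Definition lebesgue4 : {measure set space4 -> \bar R} :=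
  (@lebesgue_measure R \x @lebesgue_measure R \x @lebesgue_measure R
    \x @lebesgue_measure R)%E.

Definition vec4 (y : space4) : 'cV[R]_4 :=
  \col_(n < 4) [:: y.1.1.1; y.1.1.2; y.1.2; y.2]`_n.

Definition unvec4 (v : 'cV[R]_4) : space4 :=
  (v (@Ordinal 4 0 isT) 0, v (@Ordinal 4 1 isT) 0,
   v (@Ordinal 4 2 isT) 0, v (@Ordinal 4 3 isT) 0).

Definition measurable_estimator k (g : 'cV[R]_4 -> 'cV[R]_k) : Prop :=
  forall i, measurable_fun [set: space4] (fun y => g (vec4 y) i 0).

Definition mvn_pdf n (mu : 'cV[R]_n) (C : 'M[R]_n) (y : 'cV[R]_n) : R :=
  (Num.sqrt ((2 * pi) ^+ n * \det C))^-1
  * expR (- (((y - mu)^T *m invmx C *m (y - mu)) 0 0 / 2)).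

Context d (T : measurableType d) (Pr : probability T R).

Definition has_density (Y : T -> 'cV[R]_4) (p : 'cV[R]_4 -> R) : Prop :=
  measurable_fun [set: T] (unvec4 \o Y) /\
  forall A : set space4, measurable A ->
    Pr ((unvec4 \o Y) @^-1` A) = (\int[lebesgue4]_(y in A) (p (vec4 y))%:E)%E.

(* The law N(mu, C), for an invertible covariance matrix C. *)
Definition mvn_distributed (Y : T -> 'cV[R]_4) (mu : 'cV[R]_4) (C : 'M[R]_4) :=
  has_density Y (mvn_pdf mu C).

(* Entry i of the score, for a family p of densities indexed by the parameter *)
Definition score k (p : 'cV[R]_k.+1 -> 'cV[R]_4 -> R) (X : 'cV[R]_k.+1)
    (y : 'cV[R]_4) (i : 'I_k.+1) : R :=
  'D_(delta_mx i 0) (fun t => ln (p t y)) X.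

(* Fisher information at X carried by an observation Y whose density is p X *)
Definition fisher_information k (p : 'cV[R]_k.+1 -> 'cV[R]_4 -> R)
    (Y : T -> 'cV[R]_4) (X : 'cV[R]_k.+1) : 'M[R]_k.+1 :=
  \matrix_(i, j)
    fine ('E_Pr[(fun w => score p X (Y w) i * score p X (Y w) j)%R])%E.

Definition covariance_matrix k (Z : T -> 'cV[R]_k) : 'M[R]_k :=
  \matrix_(i, j) fine (covariance Pr (fun w => Z w i 0) (fun w => Z w j 0)).

Definition rmse k (Z : T -> 'cV[R]_k) (X : 'cV[R]_k) : R :=
  Num.sqrt (fine ('E_Pr[(fun w => norm2 (Z w - X) ^+ 2)%R])%E).

(* [Y t] is the observation when the parameter equals t. *)
Definition unbiased k (Theta : set 'cV[R]_k) (Y : 'cV[R]_k -> T -> 'cV[R]_4)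
    (g : 'cV[R]_4 -> 'cV[R]_k) : Prop :=
  forall t, Theta t -> forall i,
    (fun w => g (Y t w) i 0) \in Lfun Pr 1 /\
    ('E_Pr[(fun w => g (Y t w) i 0)%R] = (t i 0)%:E)%E.

Definition finite_second_moments k (Z : T -> 'cV[R]_k) : Prop :=
  forall i, (fun w => Z w i 0) \in Lfun Pr 2%:E.

Definition position_error_bound (J : 'M[R]_3) : R :=
  Num.sqrt (\tr (invmx J)).

End statistics.

(* Main.v *)
Require Import Defs.
From mathcomp Require Import all_boot all_order all_algebra.
From mathcomp Require Import all_classical all_reals all_analysis.
From HB Require Import structures.
From mathcomp Require Import measurable_realfun complex ring lra.
Set Implicit Arguments.
Unset Strict Implicit.
Unset Printing Implicit Defensive.
Import Order.TTheory GRing.Theory Num.Theory.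
Import numFieldNormedType.Exports.
Local Open Scope classical_set_scope.
Local Open Scope ring_scope.

(** The information inequality is obtained as a limit of Chapman-Robbins
    inequalities, which avoids differentiating under the integral sign.  The
    densities at t and at the true position X differ by a translation of the
    Gaussian noise, so their ratio L is the Cameron-Martin exponential, with mean
    1 and second moment exp q(t), q(t) = sum_n (d_n(t) - d_n(X))^2 / V_n.  For an
    unbiased estimator with centred linear form G = u . (g - X), the inequality
    0 <= E (G - k (L - 1))^2 reads
      2 k u . (t - X) - k^2 (exp q(t) - 1) <= Var (u . g).
    Taking t = X + h v, k = 1 / h and h -> 0 gives
      2 u . v - v^T I v <= Var (u . g), and v = I^-1 u is the claim.

    The Fisher matrix needs the second moments of the noise.  These also follow
    from translations: E exp (h Z) = exp (h^2 v / 2) for a linear form Z of the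
    noise, and (exp (h Z) + exp (- h Z) - 2) / h^2 tends to Z^2 as h -> 0. *)

(** * Densities and translations *)

Section densities.
Local Open Scope ereal_scope.
Context d (U : measurableType d) (R : realType).
Variables (mu nu : {measure set U -> \bar R}) (p : U -> R).
Hypotheses (p0 : forall x, (0 <= p x)%R) (mp : measurable_fun [set: U] p).
Hypothesis nuE : forall A, measurable A -> nu A = \int[mu]_(x in A) (p x)%:E.

Import HBNNSimple.

Let mEp : measurable_fun [set: U] (fun x => (p x)%:E).
Proof. exact/measurable_EFinP. Qed.

(** A simple function is a finite combination of indicators of its level sets; linearity reduces the
    claim to one indicator, where it is [nuE]. *)
Let integral_density_nnsfun (h : {nnsfun U >-> R}) :
  \int[nu]_x (h x)%:E = \int[mu]_x ((h x)%:E * (p x)%:E).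
Proof.
have mh r : measurable (h @^-1` [set r]) by exact: measurable_sfunP.
have indich r : measurable_fun [set: U] (fun x => (r * \1_(h @^-1` [set r]) x)%:E).
  by apply: (measurable_comp measurableT) => //; exact: measurable_funM.
transitivity (\int[nu]_x (\sum_(r \in range h) (r * \1_(h @^-1` [set r]) x)%:E)).
  by apply: eq_integral => t _; rewrite /= fimfunE -fsumEFin.
rewrite ge0_integral_fsum//; last by move=> r x _; exact: nnfun_muleindic_ge0.
transitivity (\int[mu]_x (\sum_(r \in range h)
    (r * \1_(h @^-1` [set r]) x)%:E * (p x)%:E)); last first.
  apply: eq_integral => t _; rewrite -ge0_mule_fsuml; last first.
    by move=> r; exact: nnfun_muleindic_ge0.
  by rewrite /= [in RHS]fimfunE -fsumEFin.
rewrite ge0_integral_fsum//; last 2 first.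
- by move=> r; exact: emeasurable_funM.
- by move=> r x _; rewrite mule_ge0 ?lee_fin//; exact: nnfun_muleindic_ge0.
apply: eq_fsbigr => r /[1!inE] -[x _ hxr].
under eq_integral do rewrite EFinM.
rewrite ge0_integralZl//; [|exact/measurable_EFinP|by rewrite -hxr lee_fin].
under [RHS]eq_integral do rewrite EFinM -muleA.
rewrite ge0_integralZl//; [|apply: emeasurable_funM => //; exact/measurable_EFinP
  |by move=> y _; rewrite mule_ge0 ?lee_fin|by rewrite -hxr lee_fin].
congr *%E; rewrite integral_indic// setIT nuE// integral_mkcond.
apply: eq_integral => y _; rewrite patchE indicE.
by case: ifPn; rewrite ?mul1e ?mul0e.
Qed.

(** Monotone convergence along an increasing sequence of simple functions, applied on both sides:
    multiplying by [p >= 0] keeps the sequence increasing. *)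
Lemma ge0_integral_density (f : U -> \bar R) : (forall x, 0 <= f x) ->
  measurable_fun [set: U] f ->
  \int[nu]_x f x = \int[mu]_x (f x * (p x)%:E).
Proof.
move=> f0 mf; pose h := nnsfun_approx measurableT mf.
have hf x : (EFin \o h n) x @[n --> \oo] --> f x by exact: cvg_nnsfun_approx.
have -> : \int[nu]_x f x = limn (fun n => \int[nu]_x (h n x)%:E).
  rewrite -monotone_convergence//.
  - by apply: eq_integral => x _; apply/esym/cvg_lim => //; exact: hf.
  - by move=> n; exact/measurable_EFinP.
  - by move=> n x _; rewrite lee_fin.
  - by move=> x _ a b ab; rewrite lee_fin; exact/lefP/nd_nnsfun_approx.
have -> : \int[mu]_x (f x * (p x)%:E) =
    limn (fun n => \int[mu]_x ((h n x)%:E * (p x)%:E)).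
  rewrite -monotone_convergence//.
  - apply: eq_integral => x _; apply/esym/cvg_lim => //.
    by apply: cvgeZr => //; exact: hf.
  - by move=> n; apply: emeasurable_funM => //; exact/measurable_EFinP.
  - by move=> n x _; rewrite mule_ge0 ?lee_fin.
  - move=> x _ a b ab; rewrite lee_wpmul2r ?lee_fin//.
    exact/lefP/nd_nnsfun_approx.
by under eq_fun do rewrite integral_density_nnsfun.
Qed.

End densities.

(** * Translation invariance of Lebesgue measure on R and R^4 *)

Section translations.
Context {R : realType}.
Local Notation mR := (measurableTypeR R).

(** The pushforward under the translation gives half-open intervals their length, so it is Lebesgue
    measure by uniqueness. *)
Lemma lebesgue_measure_shift (c : R) (A : set mR) : measurable A ->
  lebesgue_measure ((fun x : mR => c + x : mR) @^-1` A) = lebesgue_measure A.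
Proof.
move=> mA; have mc : measurable_fun [set: mR] (fun x : mR => c + x : mR).
  exact: measurable_funD.
apply/esym.
pose F : {mfun mR >-> mR} := HB.pack (fun x : mR => c + x : mR)
  (isMeasurableFun.Build _ _ _ _ _ mc).
apply: (@lebesgue_measure_unique _ (pushforward lebesgue_measure F)) => //.
move=> X /=; case => -[a b] /= ab <-{X}.
rewrite /pushforward.
have -> : F @^-1` `]a, b]%classic = `]a - c, b - c]%classic.
  apply/seteqP; split=> x /=; rewrite !in_itv/= => /andP[? ?]; apply/andP; split; lra.
rewrite !lebesgue_measure_itv/= !lte_fin ltrD2r; case: ifP => // _.
by rewrite -!EFinB; congr EFin; ring.
Qed.

(** The product measure integrates the [m2]-measure of sections. The section of the preimage at [x]
    is the [f2]-preimage of the section of [A] at [f1 x]; invariance of [m2] removes [f2], and a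
    change of variables under [m1] removes [f1]. *)
Lemma product_measure_preserved d1 d2 (T1 : measurableType d1)
  (T2 : measurableType d2) (m1 : {measure set T1 -> \bar R})
  (m2 : {sigma_finite_measure set T2 -> \bar R}) (f1 : T1 -> T1) (f2 : T2 -> T2) :
  measurable_fun [set: T1] f1 ->
  (forall A, measurable A -> m1 (f1 @^-1` A) = m1 A) ->
  (forall A, measurable A -> m2 (f2 @^-1` A) = m2 A) ->
  forall A, measurable A ->
    (m1 \x m2)%E ((fun x => (f1 x.1, f2 x.2)) @^-1` A) = (m1 \x m2)%E A.
Proof.
move=> mf1 m1f m2f A mA.
have mxs := measurable_fun_xsection m2 mA.
transitivity (\int[m1]_x ((m2 \o xsection A) \o f1) x)%E.
  apply: eq_integral => x _ /=.
  rewrite -[in RHS]m2f; last exact: measurable_xsection.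
  by congr (m2 _); apply/seteqP; split=> y; rewrite /xsection /= !inE.
pose F : {mfun T1 >-> T1} := HB.pack f1 (isMeasurableFun.Build _ _ _ _ _ mf1).
rewrite -[LHS](@ge0_integral_pushforward _ _ _ _ _ F mf1 m1 setT)//.
apply: eq_measure_integral => B mB _; exact: m1f.
Qed.

(** Translation by [c], written coordinate by coordinate so that it is visibly an iterated product
    map, as [product_measure_preserved] requires. *)
Definition shift4 (c : 'cV[R]_4) (y : @space4 R) : @space4 R :=
  (c (@Ordinal 4 0 isT) 0 + y.1.1.1, c (@Ordinal 4 1 isT) 0 + y.1.1.2,
   c (@Ordinal 4 2 isT) 0 + y.1.2, c (@Ordinal 4 3 isT) 0 + y.2).

Lemma unvec4K : cancel (@unvec4 R) vec4.
Proof.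
move=> v; apply/colP => -[[|[|[|[|//]]]] i]; rewrite mxE /=;
  congr (v _ _); exact: val_inj.
Qed.

Lemma shift4E c y : shift4 c y = unvec4 (c + vec4 y).
Proof. by rewrite /shift4 /unvec4 !mxE. Qed.

Lemma measurable_shift4 c : measurable_fun [set: space4] (shift4 c).
Proof.
have m1 : measurable_fun [set: @space4 R] (fun y : @space4 R => y.1.1.1).
  do 2 apply: measurableT_comp => //.
have m2 : measurable_fun [set: @space4 R] (fun y : @space4 R => y.1.1.2).
  do 2 apply: measurableT_comp => //.
have m3 : measurable_fun [set: @space4 R] (fun y : @space4 R => y.1.2).
  apply: measurableT_comp => //.
by repeat apply: measurable_fun_pair; apply: measurable_funD.
Qed.

Lemma lebesgue4_shift c (A : set (@space4 R)) : measurable A ->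
  lebesgue4 (shift4 c @^-1` A) = lebesgue4 A.
Proof.
move=> mA.
have msh r : measurable_fun [set: mR] (fun x : mR => r + x : mR).
  exact: measurable_funD.
have mpair d1 d2 (T1 : measurableType d1) (T2 : measurableType d2) (f1 : T1 -> T1)
    (f2 : T2 -> T2) : measurable_fun [set: T1] f1 -> measurable_fun [set: T2] f2 ->
    measurable_fun [set: T1 * T2] (fun x => (f1 x.1, f2 x.2)).
  by move=> m1 m2; apply: measurable_fun_pair; apply: measurableT_comp.
have sh r := @lebesgue_measure_shift r.
pose c0 := c (@Ordinal 4 0 isT) 0; pose c1 := c (@Ordinal 4 1 isT) 0.
pose c2 := c (@Ordinal 4 2 isT) 0; pose c3 := c (@Ordinal 4 3 isT) 0.
have H2 := product_measure_preserved (m1 := @lebesgue_measure R)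
  (m2 := @lebesgue_measure R) (msh c0) (sh c0) (sh c1).
have M2 := mpair _ _ _ _ _ _ (msh c0) (msh c1).
have H3 := product_measure_preserved
  (m1 := (@lebesgue_measure R \x @lebesgue_measure R)%E)
  (m2 := @lebesgue_measure R) M2 H2 (sh c2).
have M3 := mpair _ _ _ _ _ _ M2 (msh c2).
exact: (product_measure_preserved
  (m1 := (@lebesgue_measure R \x @lebesgue_measure R \x @lebesgue_measure R)%E)
  (m2 := @lebesgue_measure R) M3 H3 (sh c3) mA).
Qed.

End translations.

(** * Random vectors of R^4 with a density *)

Section densities_on_space4.
Context {R : realType}.

Lemma measurable_vec4 n : measurable_fun [set: @space4 R] (fun y => vec4 y n 0).
Proof.
case: n => -[|[|[|[|//]]]] i; under eq_fun do rewrite mxE /=.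
- by do 2 apply: measurableT_comp => //.
- by do 2 apply: measurableT_comp => //.
- by apply: measurableT_comp => //.
- exact: measurable_snd.
Qed.

Context d (T : measurableType d) (Pr : probability T R).

Lemma measurable_fun_has_density (Y : T -> 'cV[R]_4) p n : has_density Pr Y p ->
  measurable_fun [set: T] (fun w => Y w n 0).
Proof.
move=> [mY _]; under eq_fun do rewrite -[Y _]unvec4K.
exact: (measurableT_comp (measurable_vec4 n) mY).
Qed.

(** The law of [Y] is the pushforward of [Pr], and [has_density] says exactly that this measure has
    density [p] with respect to [lebesgue4]. *)
Lemma ge0_integral_has_density (Y : T -> 'cV[R]_4) (p : 'cV[R]_4 -> R)
  (f : @space4 R -> \bar R) :
  (forall y, 0 <= p y) -> measurable_fun [set: @space4 R] (p \o vec4) ->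
  has_density Pr Y p ->
  (forall y, 0 <= f y)%E -> measurable_fun [set: @space4 R] f ->
  (\int[Pr]_w f (unvec4 (Y w)) = \int[lebesgue4]_y (f y * (p (vec4 y))%:E))%E.
Proof.
move=> p0 mp [mY YE] f0 mf.
pose F : {mfun T >-> @space4 R} := HB.pack (@unvec4 R \o Y)
  (isMeasurableFun.Build _ _ _ _ _ mY).
rewrite -(@ge0_integral_density _ _ _ lebesgue4 (pushforward Pr F) (p \o vec4))//;
  last by move=> x; exact: p0.
by rewrite (@ge0_integral_pushforward _ _ _ _ _ F mY Pr setT).
Qed.

Lemma has_density_translate (Y : T -> 'cV[R]_4) (p : 'cV[R]_4 -> R) c :
  (forall y, 0 <= p y) -> measurable_fun [set: @space4 R] (p \o vec4) ->
  has_density Pr Y p ->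
  has_density Pr (fun w => c + Y w) (fun y => p (y - c)).
Proof.
move=> p0 mp [mY YE].
have unvec4D v : unvec4 (c + v) = shift4 c (unvec4 v) by rewrite shift4E unvec4K.
have mpc : measurable_fun [set: @space4 R] (fun y => p (vec4 y - c)).
  rewrite (_ : (fun y => _) = (p \o vec4) \o shift4 (- c)).
    by apply: measurableT_comp => //; exact: measurable_shift4.
  by apply/funext => y /=; rewrite shift4E unvec4K addrC.
have mS := @measurable_shift4 R c.
have preE : unvec4 \o (fun w => c + Y w) = shift4 c \o (unvec4 \o Y).
  by apply/funext => w /=; rewrite unvec4D.
split; first by rewrite preE; exact: measurableT_comp.
move=> A mA; rewrite preE comp_preimage YE; last first.
  by rewrite -[X in measurable X]setTI; exact: mS.
pose F : {mfun @space4 R >-> @space4 R} := HB.pack (shift4 c)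
  (isMeasurableFun.Build _ _ _ _ _ mS).
(* By translation invariance [lebesgue4] may be replaced by its own pushforward under the shift,
   which performs the substitution. *)
transitivity (\int[pushforward lebesgue4 F]_(y in A) (p (vec4 y - c))%:E)%E;
  last first.
  by apply: eq_measure_integral => B mB _; exact: lebesgue4_shift.
rewrite ge0_integral_pushforward//; last 2 first.
- by apply: measurable_funTS; apply/measurable_EFinP.
- by move=> y _; rewrite lee_fin p0.
apply: eq_integral => y _ /=.
by rewrite shift4E unvec4K addrC addKr.
Qed.

End densities_on_space4.

(** * Cameron-Martin formula *)

Section diagonal_covariance.
Context {R : realType}.

Lemma invmx_diag n (V : 'I_n -> R) : (forall i, V i != 0) ->
  invmx (diag_mx (\row_i V i)) = diag_mx (\row_i (V i)^-1).
Proof.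
move=> V0; have VK : diag_mx (\row_i V i) *m diag_mx (\row_i (V i)^-1) = 1%:M.
  rewrite mulmx_diag; apply/matrixP => i j; rewrite !mxE.
  by case: eqP => // ->; rewrite mulfV.
have [u _] := mulmx1_unit VK.
by rewrite -[LHS]mulmx1 -VK mulKmx.
Qed.

Lemma quad_invmx_diag n (V : 'I_n -> R) (x y : 'cV[R]_n) : (forall i, V i != 0) ->
  (x^T *m invmx (diag_mx (\row_i V i)) *m y) 0 0 = \sum_i x i 0 * y i 0 / V i.
Proof.
move=> V0; rewrite invmx_diag// mul_mx_diag mxE; apply: eq_bigr => i _.
by rewrite !mxE mulrAC.
Qed.

Context (V : 'I_4 -> R) (V_gt0 : forall i, 0 < V i).
Let V_neq0 i : V i != 0. Proof. exact: lt0r_neq0. Qed.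
Local Notation C := (diag_mx (\row_i V i)).

Lemma mvn_pdf_diag (mu y : 'cV[R]_4) : mvn_pdf mu C y =
  (Num.sqrt ((2 * pi) ^+ 4 * \prod_i V i))^-1
  * expR (- ((\sum_i (y i 0 - mu i 0) ^+ 2 / V i) / 2)).
Proof.
rewrite /mvn_pdf quad_invmx_diag// det_diag; congr (_^-1 * expR (- (_ / _))).
  by congr (Num.sqrt (_ * _)); apply: eq_bigr => i _; rewrite mxE.
by apply: eq_bigr => i _; rewrite !mxE expr2.
Qed.

Lemma mvn_pdf_diag_gt0 (mu y : 'cV[R]_4) : 0 < mvn_pdf mu C y.
Proof.
rewrite mvn_pdf_diag mulr_gt0 ?expR_gt0// invr_gt0 sqrtr_gt0 mulr_gt0//.
  by rewrite exprn_gt0// mulr_gt0// pi_gt0.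
exact: prodr_gt0.
Qed.

Lemma measurable_mvn_pdf_diag (mu : 'cV[R]_4) :
  measurable_fun [set: @space4 R] (mvn_pdf mu C \o vec4).
Proof.
under [X in measurable_fun _ X]eq_fun do rewrite /= mvn_pdf_diag.
apply: measurable_funM => //; apply: measurableT_comp => //.
apply: measurableT_comp => //; apply: measurable_funM => //.
apply: measurable_sum => i; apply: measurable_funM => //.
by apply: measurable_funX; apply: measurable_funB => //; exact: measurable_vec4.
Qed.

(** The Cameron-Martin exponential: the density of N(c, C) divided by that of N(0, C), at [v]. *)
Definition likelihood_ratio (c v : 'cV[R]_4) : R :=
  expR (\sum_i c i 0 * v i 0 / V i - (\sum_i c i 0 ^+ 2 / V i) / 2).

Lemma measurable_likelihood_ratio c :
  measurable_fun [set: @space4 R] (likelihood_ratio c \o vec4).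
Proof.
apply: measurableT_comp => //; apply: measurable_funB => //.
apply: measurable_sum => i; apply: measurable_funM => //.
by apply: measurable_funM => //; exact: measurable_vec4.
Qed.

Lemma mvn_pdf_likelihood_ratio c v :
  mvn_pdf c C v = likelihood_ratio c v * mvn_pdf 0 C v.
Proof.
rewrite !mvn_pdf_diag mulrCA -expRD; congr (_ * expR _).
have -> : \sum_i (v i 0 - c i 0) ^+ 2 / V i =
    \sum_i (v i 0 - (0 : 'cV[R]_4) i 0) ^+ 2 / V i
    - 2 * (\sum_i c i 0 * v i 0 / V i) + \sum_i c i 0 ^+ 2 / V i.
  rewrite mulr_sumr -sumrB -big_split/=; apply: eq_bigr => i _.
  by rewrite mxE; field; rewrite V_neq0.
by field.
Qed.

Context d (T : measurableType d) (Pr : probability T R) (e : T -> 'cV[R]_4).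
Hypothesis He : mvn_distributed Pr e 0 C.

Lemma has_density_translate_mvn c :
  has_density Pr (fun w => c + e w) (mvn_pdf c C).
Proof.
have -> : mvn_pdf c C = (fun y => mvn_pdf 0 C (y - c)).
  by apply/funext => y; rewrite /mvn_pdf subr0.
apply: has_density_translate => //; last exact: measurable_mvn_pdf_diag.
by move=> y; exact/ltW/mvn_pdf_diag_gt0.
Qed.

(** Both sides are integrals against [lebesgue4], with the densities of N(c, C) and N(0, C), whose
    ratio is [likelihood_ratio c]. *)
Lemma ge0_cameron_martin c (f : @space4 R -> \bar R) :
  (forall y, 0 <= f y)%E -> measurable_fun [set: @space4 R] f ->
  (\int[Pr]_w f (unvec4 (c + e w)) =
   \int[Pr]_w (f (unvec4 (e w)) * (likelihood_ratio c (e w))%:E))%E.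
Proof.
move=> f0 mf.
rewrite (ge0_integral_has_density _ _ (has_density_translate_mvn c) f0 mf);
  [|by move=> y; exact/ltW/mvn_pdf_diag_gt0|exact: measurable_mvn_pdf_diag].
pose g y := (f y * (likelihood_ratio c (vec4 y))%:E)%E.
rewrite [RHS](_ : _ = \int[Pr]_w g (unvec4 (e w)))%E; last first.
  by apply: eq_integral => w _; rewrite /g unvec4K.
rewrite (ge0_integral_has_density _ _ He);
  [|by move=> y; exact/ltW/mvn_pdf_diag_gt0|exact: measurable_mvn_pdf_diag| |].
- by apply: eq_integral => y _; rewrite /g mvn_pdf_likelihood_ratio EFinM muleA.
- by move=> y; rewrite mule_ge0// lee_fin expR_ge0.
- apply: emeasurable_funM => //; apply/measurable_EFinP.
  exact: measurable_likelihood_ratio.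
Qed.

(** The nonnegative case is applied to the absolute value of [h] for integrability, then to its
    positive and negative parts, which commute with the nonnegative factor [likelihood_ratio]. *)
Lemma cameron_martin c (h : @space4 R -> R) : measurable_fun [set: @space4 R] h ->
  Pr.-integrable [set: T] (fun w => (h (unvec4 (c + e w)))%:E) ->
  Pr.-integrable [set: T]
    (fun w => (h (unvec4 (e w)) * likelihood_ratio c (e w))%:E) /\
  (\int[Pr]_w (h (unvec4 (c + e w)))%:E =
   \int[Pr]_w (h (unvec4 (e w)) * likelihood_ratio c (e w))%:E)%E.
Proof.
move=> mh ih.
have me : measurable_fun [set: T] (unvec4 \o e) by case: He.
have mEh : measurable_fun [set: @space4 R] (EFin \o h) by exact/measurable_EFinP.
split.
  apply/integrableP; split.
    apply/measurable_EFinP; apply: measurable_funM; first exact: measurableT_comp.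
    under eq_fun do rewrite -[e _]unvec4K.
    exact: (measurableT_comp (measurable_likelihood_ratio c) me).
  case/integrableP: ih => _.
  rewrite (ge0_cameron_martin c (f := fun y => `|(h y)%:E|%E))//; last first.
    exact: measurableT_comp.
  congr (_ < _)%E; apply: eq_integral => w _; rewrite EFinM abseM.
  by congr (_ * _)%E; rewrite gee0_abs// lee_fin expR_ge0.
rewrite integralE [RHS]integralE; congr (_ - _)%E.
  transitivity (\int[Pr]_w (EFin \o h)^\+ (unvec4 (c + e w)))%E.
    by apply: eq_integral => w _; rewrite !funeposE.
  rewrite ge0_cameron_martin//; last exact: measurable_funepos.
  apply: eq_integral => w _; rewrite !funeposE /= EFinM.
  by rewrite maxe_pMl ?lee_fin ?expR_ge0// mul0e.
transitivity (\int[Pr]_w (EFin \o h)^\- (unvec4 (c + e w)))%E.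
  by apply: eq_integral => w _; rewrite !funenegE.
rewrite ge0_cameron_martin//; last exact: measurable_funeneg.
apply: eq_integral => w _; rewrite !funenegE /= -mulNr EFinM.
by rewrite maxe_pMl ?lee_fin ?expR_ge0// mul0e.
Qed.

End diagonal_covariance.

(** * Second moments from exponential moments *)

Section second_moment.
Context {R : realType}.

(** Sum of the estimates u <= exp u - 1 <= u exp u and u exp(-u) <= 1 - exp(-u) <= u, all
    consequences of 1 + x <= exp x at u and -u. *)
Let sinh_bounds (u : R) : 0 <= u ->
  u * (1 + expR (- u)) <= expR u - expR (- u) <= u * (1 + expR u).
Proof.
move=> u0; have e1 := expR_ge1Dx u; have e2 := expR_ge1Dx (- u).
have e0 := expR_gt0 u; have eN0 := expR_gt0 (- u).
have eK : expR u * expR (- u) = 1 by rewrite -expRD subrr expR0.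
apply/andP; split; nra.
Qed.

(** The symmetric second difference quotient at 0 of the exponential with rate [x]; it tends to x^2
    as h tends to 0. *)
Let cosh_quotient (h x : R) : R := (expR (h * x) + expR (- (h * x)) - 2) / h ^+ 2.

(** A perfect square, since exp t + exp(-t) - 2 = (exp(t/2) - exp(-t/2))^2. Evenness in [x] allows
    the absolute value, which makes the argument nonnegative for [sinh_bounds] when h > 0. *)
Let cosh_quotientE (h x : R) : cosh_quotient h x =
  ((expR (h * `|x| / 2) - expR (- (h * `|x| / 2))) / h) ^+ 2.
Proof.
have sq t : expR t + expR (- t) - 2 = (expR (t / 2) - expR (- (t / 2))) ^+ 2.
  have eK : expR (t / 2) * expR (- (t / 2)) = 1 by rewrite -expRD subrr expR0.
  have -> : t = t / 2 + t / 2 by field.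
  by rewrite opprD !expRD -splitr; nra.
rewrite /cosh_quotient expr_div_n -sq; congr (_ / _).
by have [x0|x0] := ger0P x; [|rewrite mulrN opprK; ring].
Qed.

Let cosh_quotient_bounds (h x : R) : 0 < h ->
  (`|x| / 2 * (1 + expR (- (h * `|x| / 2)))) ^+ 2 <= cosh_quotient h x
  <= (`|x| / 2 * (1 + expR (h * `|x| / 2))) ^+ 2.
Proof.
move=> h0; rewrite cosh_quotientE.
have x0 := normr_ge0 x.
have u0 : 0 <= h * `|x| / 2 by rewrite divr_ge0// mulr_ge0// ltW.
have /andP[lo hi] := sinh_bounds u0.
have e0 := expR_gt0 (h * `|x| / 2); have eN0 := expR_gt0 (- (h * `|x| / 2)).
have lo' : `|x| / 2 * (1 + expR (- (h * `|x| / 2))) <=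
    (expR (h * `|x| / 2) - expR (- (h * `|x| / 2))) / h.
  by rewrite ler_pdivlMr//; lra.
have hi' : (expR (h * `|x| / 2) - expR (- (h * `|x| / 2))) / h <=
    `|x| / 2 * (1 + expR (h * `|x| / 2)).
  by rewrite ler_pdivrMr//; lra.
have lo0 : 0 <= `|x| / 2 * (1 + expR (- (h * `|x| / 2))).
  by rewrite mulr_ge0 ?divr_ge0 ?addr_ge0 ?expR_ge0.
by rewrite !lerXn2r ?nnegrE ?(le_trans lo0)// (le_trans lo')//.
Qed.

Let cvg_expR_harmonic (c : R) : expR (c * harmonic n) @[n --> \oo] --> (1 : R).
Proof.
rewrite -(@expR0 R); apply: continuous_cvg; first exact: continuous_expR.
by rewrite -[X in _ --> X](mulr0 c); apply: cvgMr; exact: cvg_harmonic.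
Qed.

Let cvg_cosh_quotient (x : R) :
  cosh_quotient (harmonic n) x @[n --> \oo] --> x ^+ 2.
Proof.
have lim (c : R) : (`|x| / 2 * (1 + expR (c * harmonic n))) ^+ 2 @[n --> \oo] --> x ^+ 2.
  have -> : x ^+ 2 = (`|x| / 2 * (1 + 1)) ^+ 2.
    by rewrite -[LHS]real_normK ?num_real//; field.
  have lin : `|x| / 2 * (1 + expR (c * harmonic n)) @[n --> \oo] --> `|x| / 2 * (1 + 1).
    by apply: cvgMr; apply: cvgD; [exact: cvg_cst|exact: cvg_expR_harmonic].
  by rewrite expr2; under eq_fun do rewrite expr2; exact: cvgM.
apply: (squeeze_cvgr _ (lim (- (`|x| / 2))) (lim (`|x| / 2))).
near=> n; have hn : 0 < harmonic n :> R by rewrite /harmonic invr_gt0.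
have := cosh_quotient_bounds x hn.
have -> : harmonic n * `|x| / 2 = `|x| / 2 * harmonic n by ring.
by rewrite -[in - (_ * _)]mulNr.
Unshelve. all: by end_near. Qed.

(** A majorant independent of [n], whose composition with [Z] is integrable by the exponential
    moments at 2 and -2. It uses [harmonic n <= 1] and y <= exp y for y = |x| / 2. *)
Let cosh_quotient_dominated n (x : R) :
  `|cosh_quotient (harmonic n) x| <= 4 * (expR (2 * x) + expR (- 2 * x)).
Proof.
have hn : 0 < harmonic n :> R by rewrite /harmonic invr_gt0.
have hn1 : harmonic n <= 1 :> R by rewrite /harmonic invf_le1// ler1n.
have /andP[lo hi] := cosh_quotient_bounds x hn.
rewrite ger0_norm; last by apply: le_trans lo; exact: sqr_ge0.
apply: (le_trans hi).
have x0 := normr_ge0 x.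
have ehalf : `|x| / 2 <= expR (`|x| / 2).
  by apply: le_trans (expR_ge1Dx _); rewrite lerDr.
have eh : expR (harmonic n * `|x| / 2) <= expR (`|x| / 2).
  by rewrite ler_expR; nra.
have e1 : 1 <= expR (`|x| / 2).
  by apply: le_trans (expR_ge1Dx _); rewrite lerDl divr_ge0.
have -> : expR (2 * x) + expR (- 2 * x) = expR (2 * `|x|) + expR (- 2 * `|x|).
  have [//|_] := ger0P x; rewrite addrC; congr (expR _ + expR _); ring.
have -> : expR (2 * `|x|) = expR (`|x| / 2) ^+ 4.
  by rewrite -expRM_natl; congr expR; field.
have eN := expR_ge0 (- 2 * `|x|).
apply: (@le_trans _ _ ((expR (`|x| / 2) * (2 * expR (`|x| / 2))) ^+ 2)); last by nra.
have le_factor : `|x| / 2 * (1 + expR (harmonic n * `|x| / 2)) <=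
    expR (`|x| / 2) * (2 * expR (`|x| / 2)).
  by apply: ler_pM; rewrite ?divr_ge0 ?addr_ge0 ?expR_ge0//; lra.
by rewrite !expr2; apply: ler_pM => //; rewrite mulr_ge0 ?divr_ge0 ?addr_ge0 ?expR_ge0.
Qed.

Context d (T : measurableType d) (Pr : probability T R) (Z : T -> R) (v : R).
Hypotheses (mZ : measurable_fun [set: T] Z) (v_ge0 : 0 <= v).
Hypothesis mgf : forall h,
  (\int[Pr]_w (expR (h * Z w))%:E = (expR (h ^+ 2 * v / 2))%:E)%E.

Let integrable_mgf h : Pr.-integrable [set: T] (fun w => (expR (h * Z w))%:E).
Proof.
apply/integrableP; split.
  by apply/measurable_EFinP; apply: measurableT_comp => //; exact: measurable_funM.
under eq_integral do rewrite gee0_abs ?lee_fin ?expR_ge0//.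
by rewrite mgf ltry.
Qed.

Let integral_cosh_quotient h : h != 0 ->
  (\int[Pr]_w (cosh_quotient h (Z w))%:E =
   ((expR (h ^+ 2 * v / 2) - 1) * 2 / h ^+ 2)%:E)%E.
Proof.
move=> h0.
under eq_integral => w _.
  rewrite (_ : cosh_quotient h (Z w) =
    (h ^+ 2)^-1 * (expR (h * Z w) + expR (- h * Z w) - 2)); last first.
    by rewrite /cosh_quotient mulrC mulNr.
  rewrite EFinM EFinB EFinD; over.
rewrite integralZl//; last first.
  by apply: integrableB => //; [exact: integrableD|exact: finite_measure_integrable_cst].
rewrite integralB//; [|exact: integrableD|exact: finite_measure_integrable_cst].
rewrite integralD// !mgf (_ : \int[Pr]__ 2%:E = 2%:E)%E; last first.
  rewrite (integral_cst Pr measurableT). by rewrite /= (@probability_setT _ _ _ Pr) mule1.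
set E := expR _; set E' := expR _.
have -> : E' = E by rewrite /E' sqrrN.
by transitivity (((h ^+ 2)^-1 * (E + E - 2))%:E) => //; congr EFin; field.
Qed.

(** Dominated convergence for [cosh_quotient] along h = 1 / (n + 1): the integrands tend to Z^2,
    while their integrals are explicit and tend to [v]. *)
Lemma second_moment_of_mgf : Pr.-integrable [set: T] (fun w => (Z w ^+ 2)%:E) /\
  (\int[Pr]_w (Z w ^+ 2)%:E = v%:E)%E.
Proof.
pose f n w := (cosh_quotient (harmonic n) (Z w))%:E.
have h0 n : harmonic n != 0 :> R by rewrite /harmonic invr_eq0 pnatr_eq0.
have mf n : measurable_fun [set: T] (f n).
  apply/measurable_EFinP; apply: measurable_funM => //.
  apply: measurable_funB => //; apply: measurable_funD.
    by apply: measurableT_comp => //; exact: measurable_funM.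
  apply: measurableT_comp => //; apply: measurableT_comp => //.
  exact: measurable_funM.
have mZ2 : measurable_fun [set: T] (fun w => (Z w ^+ 2)%:E).
  by apply/measurable_EFinP; exact: measurable_funX.
have ig : Pr.-integrable [set: T]
    (fun w => (4 * (expR (2 * Z w) + expR (- 2 * Z w)))%:E).
  exact: integrableZl (integrableD measurableT (integrable_mgf 2) (integrable_mgf (- 2))).
have cf : {ae Pr, forall w, [set: T] w -> f ^~ w @ \oo --> (Z w ^+ 2)%:E}.
  apply: aeW => w _; apply/fine_cvgP; split; first exact: nearW.
  exact: cvg_cosh_quotient.
have fg : {ae Pr, forall w n, [set: T] w ->
    `|f n w|%E <= (4 * (expR (2 * Z w) + expR (- 2 * Z w)))%:E}%E.
  by apply: aeW => w n _; rewrite lee_fin; exact: cosh_quotient_dominated.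
have [iZ _ lim] := dominated_convergence measurableT mf mZ2 cf ig fg.
split=> //; apply: (cvg_unique _ lim) => //.
have h_gt0 n : 0 < harmonic n :> R by rewrite /harmonic invr_gt0.
have h_le1 n : harmonic n <= 1 :> R by rewrite /harmonic invf_le1// ler1n.
have -> : (fun n => \int[Pr]_w f n w)%E = EFin \o (fun n =>
    (expR (harmonic n ^+ 2 * v / 2) - 1) * 2 / harmonic n ^+ 2).
  by apply/funext => n; rewrite integral_cosh_quotient.
apply/fine_cvgP; split; first exact: nearW.
(* With t = h^2 v / 2, the bounds t <= exp t - 1 <= t exp t squeeze the integral between v and v exp
   t. As h <= 1, t is at most v h / 2, which gives an upper bound with a known limit. *)
have limv : v * expR (v / 2 * harmonic n) @[n --> \oo] --> v.
  by rewrite -[X in _ --> X]mulr1; apply: cvgMr; exact: cvg_expR_harmonic.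
apply: (squeeze_cvgr _ (cvg_cst v) limv).
apply: nearW => n; set t := harmonic n ^+ 2 * v / 2.
have h2 : 0 < harmonic n ^+ 2 :> R by rewrite exprn_gt0.
have e1 := expR_ge1Dx t; have e2 := expR_ge1Dx (- t).
have eK : expR t * expR (- t) = 1 by rewrite -expRD subrr expR0.
have tE : t * 2 = v * harmonic n ^+ 2 by rewrite /t; field.
have et : expR t <= expR (v / 2 * harmonic n).
  rewrite ler_expR /t.
  have hh : 0 <= harmonic n * (1 - harmonic n) :> R.
    by apply: mulr_ge0; [exact/ltW/h_gt0|rewrite subr_ge0; exact: h_le1].
  have := mulr_ge0 v_ge0 hh; lra.
have e0 := expR_gt0 t.
apply/andP; split.
  by rewrite ler_pdivlMr// -tE; lra.
rewrite ler_pdivrMr//.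
apply: (@le_trans _ _ (t * 2 * expR t)).
  by have := ler_wpM2l (ltW e0) e2; rewrite eK; lra.
rewrite tE mulrAC; apply: ler_wpM2r; first exact: ltW.
exact: ler_wpM2l.
Qed.

End second_moment.

(** * Moments of linear forms of the Gaussian noise *)

Section gaussian_moments.
Context {R : realType} (V : 'I_4 -> R) (V_gt0 : forall i, 0 < V i).
Let V_neq0 i : V i != 0. Proof. exact: lt0r_neq0. Qed.
Context d (T : measurableType d) (Pr : probability T R) (e : T -> 'cV[R]_4).
Hypothesis He : mvn_distributed Pr e 0 (diag_mx (\row_i V i)).

Local Notation form c := (fun w => \sum_i c i * e w i 0).

Let measurable_form (c : 'I_4 -> R) : measurable_fun [set: T] (form c).
Proof.
apply: measurable_sum => i; apply: measurable_funM => //.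
exact: measurable_fun_has_density He.
Qed.

Lemma integral_likelihood_ratio c :
  (\int[Pr]_w (likelihood_ratio V c (e w))%:E = 1)%E.
Proof.
have := ge0_cameron_martin V_gt0 He c (f := cst 1%E)
  (fun=> lee01) (measurable_cst _).
rewrite integral_cst// mul1e => E; rewrite -[RHS](@probability_setT _ _ _ Pr) E.
by apply: eq_integral => w _; rewrite mul1e.
Qed.

(** Completing the square: for the shift [l] with entries [V i * c i], the likelihood ratio has the
    given form as linear term, so the exponential is [expR (q / 2)] times a function of mean 1. *)
Lemma mgf_mvn (c : 'I_4 -> R) :
  (\int[Pr]_w (expR (form c w))%:E = (expR ((\sum_i V i * c i ^+ 2) / 2))%:E)%E.
Proof.
pose l : 'cV[R]_4 := \col_i (V i * c i).
set q := \sum_i V i * c i ^+ 2.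
have LE (v : 'cV[R]_4) :
    expR (\sum_i c i * v i 0) = expR (q / 2) * likelihood_ratio V l v.
  rewrite -expRD addrC; congr expR; rewrite (_ : \sum_i l i 0 ^+ 2 / V i = q); last first.
    by apply: eq_bigr => i _; rewrite mxE; field; exact: V_neq0.
  by rewrite subrK; apply: eq_bigr => i _; rewrite mxE; field; exact: V_neq0.
under eq_integral do rewrite LE EFinM.
rewrite ge0_integralZl//;
  [|apply/measurable_EFinP|by move=> w _; rewrite lee_fin expR_ge0].
  by rewrite integral_likelihood_ratio mule1.
under eq_fun do rewrite -[e _]unvec4K.
by apply: (measurableT_comp (measurable_likelihood_ratio V l)); case: He.
Qed.

(** Squares come from [second_moment_of_mgf], whose hypothesis is [mgf_mvn] for the rescaled
    coefficients [h * a i]; products follow by polarization. *)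
Lemma mvn_second_moment (c c' : 'I_4 -> R) :
  Pr.-integrable [set: T] (fun w => (form c w * form c' w)%:E) /\
  (\int[Pr]_w (form c w * form c' w)%:E = (\sum_i V i * c i * c' i)%:E)%E.
Proof.
have sq (a : 'I_4 -> R) : Pr.-integrable [set: T] (fun w => (form a w ^+ 2)%:E) /\
    (\int[Pr]_w (form a w ^+ 2)%:E = (\sum_i V i * a i ^+ 2)%:E)%E.
  apply: second_moment_of_mgf; first exact: measurable_form.
    by apply: sumr_ge0 => i _; rewrite mulr_ge0 ?sqr_ge0 ?ltW.
  move=> h; under eq_integral do rewrite mulr_sumr.
  transitivity (\int[Pr]_w (expR (form (fun i => (h * a i)) w))%:E)%E.
    apply: eq_integral => w _; congr (expR _)%:E.
    by apply: eq_bigr => i _; rewrite mulrA.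
  rewrite mgf_mvn mulr_sumr; congr (expR (_ / 2))%:E.
  by apply: eq_bigr => i _; ring.
pose s := fun i => (c i + c' i); pose t := fun i => (c i - c' i).
have polar w : form c w * form c' w = 4^-1 * (form s w ^+ 2 - form t w ^+ 2).
  have -> : form s w = form c w + form c' w.
    by rewrite -big_split; apply: eq_bigr => i _; rewrite mulrDl.
  have -> : form t w = form c w - form c' w.
    by rewrite -sumrB; apply: eq_bigr => i _; rewrite mulrBl.
  by field.
have [i1 sE] := sq s; have [i2 tE] := sq t.
have iB := integrableB measurableT i1 i2.
under eq_fun do rewrite polar EFinM EFinB.
split; first exact: integrableZl.
rewrite integralZl// integralB// sE tE.
transitivity ((4^-1 * (\sum_i V i * s i ^+ 2 - \sum_i V i * t i ^+ 2))%:E) => //.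
rewrite -sumrB mulr_sumr; congr EFin; apply: eq_bigr => i _; by rewrite /s /t; field.
Qed.

End gaussian_moments.

(** * Distances and ranging variances *)

Section geometry.
Context {R : realType}.

Lemma norm2_sqr n (v : 'cV[R]_n) : norm2 v ^+ 2 = \sum_i v i 0 ^+ 2.
Proof. by apply: sqr_sqrtr; apply: sumr_ge0 => i _; exact: sqr_ge0. Qed.

Lemma norm2_gt0 n (v : 'cV[R]_n) : v != 0 -> 0 < norm2 v.
Proof.
move=> v0; have p0 i : true -> 0 <= v i 0 ^+ 2 by rewrite sqr_ge0.
have [i [j]] := matrix0Pn _ v0; rewrite ord1 => vi.
rewrite sqrtr_gt0 (bigD1 i)//= ltr_pwDl//; first by rewrite exprn_even_gt0.
by apply: sumr_ge0 => k _; exact: p0.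
Qed.

Lemma is_derive_line (W : normedModType R) (f : W -> R) (X v : W) (df : R) :
  is_derive (0 : R) 1 (fun h : R => f (h *: v + X)) df -> is_derive X v f df.
Proof.
move=> [cf <-]; apply: DeriveDef; first exact/derivable1P.
rewrite /derive; do 2 f_equal; apply/funext => h /=.
by rewrite addr0 scale0r add0r [h *: 1]mulr1.
Qed.

(** Chain rule for the square root of the quadratic polynomial [g]; [u != 0] gives [g 0 > 0], where
    the root is differentiable. *)
Lemma is_derive_norm2_line n (u v : 'cV[R]_n) : u != 0 ->
  is_derive (0 : R) 1 (fun h : R => norm2 (h *: v + u))
    ((\sum_i u i 0 * v i 0) / norm2 u).
Proof.
move=> u0; have nu := norm2_gt0 u0.
pose g := fun h : R => \sum_i (h * v i 0 + u i 0) ^+ 2.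
have g0 : g 0 = norm2 u ^+ 2.
  by rewrite norm2_sqr; apply: eq_bigr => i _; rewrite mul0r add0r.
have -> : (fun h : R => norm2 (h *: v + u)) = Num.sqrt \o g.
  by apply/funext => h /=; congr Num.sqrt; apply: eq_bigr => i _; rewrite !mxE.
have dg : is_derive (0 : R) 1 g (2 * \sum_i u i 0 * v i 0).
  rewrite (_ : g = \sum_i (fun h : R => (h * v i 0 + u i 0) ^+ 2)); last first.
    by apply/funext => h; rewrite fct_sumE.
  rewrite mulr_sumr; apply: is_derive_sum => i.
  rewrite (_ : (fun h => _) = ((v i 0 \*: (@id R) + cst (u i 0)) ^+ 2)); last first.
    by apply/funext => h /=; rewrite !fctE mulrC.
  apply: is_derive_eq; rewrite !fctE/=.
  by rewrite expr1 scaler0 add0r addr0 [_ *: 1]mulr1 [RHS]mulrA.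
have ds : is_derive (g 0) 1 (@Num.sqrt R) (2 * Num.sqrt (g 0))^-1.
  by apply: is_derive1_sqrt; rewrite g0 exprn_gt0.
apply: is_derive_eq (is_derive1_comp ds dg) _.
by rewrite g0 sqrtr_sqr gtr0_norm//; field; rewrite lt0r_neq0.
Qed.

Context (a : 'I_4 -> 'cV[R]_3).

Lemma is_derive_distances (X v : 'cV[R]_3) n : X != a n ->
  is_derive X v (fun t : 'cV[R]_3 => distances a t n 0)
    ((\sum_i (X - a n) i 0 * v i 0) / norm2 (X - a n)).
Proof.
move=> Xa; apply: is_derive_line.
under eq_fun do rewrite mxE /displacement -addrA.
by apply: is_derive_norm2_line; rewrite subr_eq0.
Qed.

Lemma partials_distances (X : 'cV[R]_3) n i : X != a n ->
  partials (distances a) X n i = (X - a n) i 0 / norm2 (X - a n).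
Proof.
move=> Xa; rewrite mxE; have := is_derive_distances (delta_mx i 0) Xa.
move=> /(@derive_val _ _ _) ->; congr (_ / _).
rewrite (bigD1 i)//= [delta_mx _ _ _ _]mxE !eqxx mulr1 big1 ?addr0// => j ji.
by rewrite [delta_mx _ _ _ _]mxE (negbTE ji) mulr0.
Qed.

(** Derivatives in every direction, beyond the coordinate ones that define [partials]; the limit
    along [X + h v] needs them. *)
Lemma derive_distances (X v : 'cV[R]_3) n : X != a n ->
  is_derive X v (fun t : 'cV[R]_3 => distances a t n 0)
    ((partials (distances a) X *m v) n 0).
Proof.
move=> Xa; apply: is_derive_eq (is_derive_distances v Xa) _.
rewrite mxE mulr_suml; apply: eq_bigr => i _.
by rewrite partials_distances// mulrAC.
Qed.

End geometry.

(** * Positivity of the ranging variances *)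

Section ranging.
Context {R : realType} (s : system R).
Hypothesis Hphys : physical s.

Local Notation normc := ComplexField.Normc.normc.

(** Phases have modulus 1, so the waveguide and line-of-sight factors never vanish. *)
Lemma normc_cexp (z : R[i]%C) : normc (cexp z) = expR (complex.Re z).
Proof.
case: z => x y; rewrite /cexp /normc /= !exprMn -mulrDr cos2Dsin2 mulr1.
by rewrite sqrtr_sqr gtr0_norm ?expR_gt0.
Qed.

Lemma avg_noise_gt0 an : 0 < avg_noise s an.
Proof.
case: Hphys => [[c0 f0 w0] [n0 p0 P0]].
have w1 : 0 < normc (waveguide s an) by rewrite /waveguide normc_cexp expR_gt0.
by apply: divr_gt0 => //; apply: mulr_gt0; [rewrite mulr_gt0// ltr0n|rewrite exprn_gt0].
Qed.

Lemma normc_los_amplitude_gt0 r : 0 < r -> 0 < normc (los_amplitude s r).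
Proof.
case: Hphys => [[c0 f0 w0] [n0 p0 P0]] r0.
rewrite /los_amplitude ComplexField.Normc.normcM normc_cexp expR0 mulr1.
rewrite /normc /= expr0n addr0 sqrtr_sqr normr_gt0 lt0r_neq0// divr_gt0//.
by rewrite !mulr_gt0// pi_gt0.
Qed.

Lemma ranging_factor_gt0 A : admissible A s -> 0 < ranging_factor A s.
Proof.
case: A => /= [/andP[M0 MK]|MK].
  have M0' : 0 < (pencil s)%:R :> R by rewrite ltr0n.
  have K0 : 0 < (nsubcarriers s)%:R - (pencil s)%:R :> R by rewrite subr_gt0 ltr_nat.
  by case: ifP => _; rewrite divr_gt0// mulr_gt0// exprn_gt0.
have M0 : 0 < (pencil s)%:R + 1 :> R by rewrite ltr_wpDl.
have K0 : 0 < (nsubcarriers s)%:R - (pencil s)%:R - 1 :> R.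
  by rewrite -addrA -opprD subr_gt0 natr1 ltr_nat -addn1.
by rewrite divr_gt0 ?lt_min ?M0 ?K0// mulr_gt0// exprn_gt0.
Qed.

Lemma ranging_variance_gt0 A (a : 'I_4 -> 'cV[R]_3) X n : admissible A s ->
  X != a n -> 0 < ranging_variance A s a X n.
Proof.
move=> adm Xa; case: (Hphys) => [[c0 f0 w0] _].
have l0 : 0 < normc (los_amplitude s (norm2 (displacement a X n))).
  by apply: normc_los_amplitude_gt0; apply: norm2_gt0; rewrite subr_eq0.
have g0 : 0 < light_speed s / (2 * pi * spacing s).
  by rewrite divr_gt0// !mulr_gt0// pi_gt0.
rewrite /ranging_variance; apply: mulr_gt0; last exact: ranging_factor_gt0.
apply: mulr_gt0; first by rewrite exprn_gt0.
by apply: divr_gt0; [exact: avg_noise_gt0|rewrite exprn_gt0].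
Qed.

End ranging.

(** * Information inequality *)

Section has_mean.
Context d (T : measurableType d) (R : realType) (Pr : probability T R).
Implicit Types (f g : T -> R) (m n : R).

(** Integrability and value are bundled so that both pass together through linear combinations. *)
Definition has_mean f m : Prop :=
  Pr.-integrable [set: T] (EFin \o f) /\ (\int[Pr]_w (f w)%:E = m%:E)%E.

Lemma has_mean_fine f : Pr.-integrable [set: T] (EFin \o f) ->
  has_mean f (fine (\int[Pr]_w (f w)%:E)).
Proof.
move=> fi; split => //; rewrite fineK//.
by apply: integrable_fin_num.
Qed.

Lemma eq_has_mean f g m : f =1 g -> has_mean f m -> has_mean g m.
Proof. by move=> /funext ->. Qed.

Lemma has_mean_cst m : has_mean (cst m) m.
Proof.
split; first exact: finite_measure_integrable_cst.
transitivity (\int[Pr]_w (cst m%:E w))%E => //.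
by rewrite (integral_cst Pr measurableT) /= (@probability_setT _ _ _ Pr) mule1.
Qed.

Lemma has_meanD f g m n : has_mean f m -> has_mean g n ->
  has_mean (fun w => f w + g w) (m + n).
Proof.
move=> [fi fm] [gi gn]; split; first exact: integrableD fi gi.
under eq_integral do rewrite EFinD.
by rewrite (integralD measurableT fi gi) fm gn.
Qed.

Lemma has_meanZ k f m : has_mean f m -> has_mean (fun w => k * f w) (k * m).
Proof.
move=> [fi fm]; split; first exact: (integrableZl measurableT k fi).
under eq_integral do rewrite EFinM.
by rewrite (integralZl measurableT fi) fm.
Qed.

Lemma has_meanB f g m n : has_mean f m -> has_mean g n ->
  has_mean (fun w => f w - g w) (m - n).
Proof.
move=> fm gn; have := has_meanD fm (has_meanZ (-1) gn).
by rewrite mulN1r; apply: eq_has_mean => w; rewrite mulN1r.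
Qed.

Lemma has_mean_sum I (s : seq I) (f : I -> T -> R) (m : I -> R) :
  (forall i, has_mean (f i) (m i)) ->
  has_mean (fun w => \sum_(i <- s) f i w) (\sum_(i <- s) m i).
Proof.
move=> fm; elim: s => [|i s IHs].
  by rewrite big_nil; apply: eq_has_mean (has_mean_cst 0) => w; rewrite big_nil.
rewrite big_cons; apply: eq_has_mean (has_meanD (fm i) IHs) => w.
by rewrite big_cons.
Qed.

Lemma ge0_has_mean f m : measurable_fun [set: T] f -> (forall w, 0 <= f w) ->
  (\int[Pr]_w (f w)%:E = m%:E)%E -> has_mean f m.
Proof.
move=> mf f0 fm; split=> //; apply/integrableP; split; first exact/measurable_EFinP.
under eq_integral do rewrite /= ger0_norm//.
by rewrite fm ltry.
Qed.

Lemma has_mean_ge0 f m : (forall w, 0 <= f w) -> has_mean f m -> 0 <= m.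
Proof.
by move=> f0 [_ fm]; rewrite -lee_fin -fm; apply: integral_ge0 => w _; rewrite lee_fin.
Qed.

End has_mean.

(** * Score, Fisher information and Cramér-Rao bound for the distance model *)

Section localization.
Context {R : realType} (V : 'I_4 -> R) (V_gt0 : forall i, 0 < V i).
Context (a : 'I_4 -> 'cV[R]_3) (X : 'cV[R]_3) (Xa : forall n, X != a n).
Let V_neq0 i : V i != 0. Proof. exact: lt0r_neq0. Qed.
Local Notation C := (diag_mx (\row_i V i)).
Local Notation J := (partials (distances a) X).
Local Notation p := (fun (t : 'cV[R]_3) (y : 'cV[R]_4) => mvn_pdf (distances a t) C y).

Lemma ln_mvn_pdf_diag (mu y : 'cV[R]_4) : ln (mvn_pdf mu C y) =
  ln (Num.sqrt ((2 * pi) ^+ 4 * \prod_i V i))^-1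
  - 1 / 2 * \sum_i (y i 0 - mu i 0) ^+ 2 / V i.
Proof.
rewrite mvn_pdf_diag// lnM ?expRK ?posrE ?expR_gt0//; last first.
  rewrite invr_gt0 sqrtr_gt0 mulr_gt0 ?exprn_gt0 ?mulr_gt0 ?pi_gt0//.
  exact: prodr_gt0.
by congr (_ - _); field.
Qed.

(** [C] stays fixed as the parameter varies, so the normalizing constant drops out and only the
    quadratic form is differentiated. At [y = d(X) + e] the score is thus a linear form of the
    noise. *)
Lemma score_distances (y : 'cV[R]_4) i :
  score p X y i = \sum_n (J n i / V n) * (y n 0 - distances a X n 0).
Proof.
rewrite /score; under eq_fun do rewrite ln_mvn_pdf_diag.
set k := ln _.
pose D n := fun t : 'cV[R]_3 => distances a t n 0.
rewrite (_ : (fun t => _) = cst k + \sum_n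
    (- (2 * V n)^-1) \*: (cst (y n 0) - D n) ^+ 2); last first.
  apply/funext => t; rewrite !fctE fct_sumE mulr_sumr -sumrN; congr (_ + _).
  apply: eq_bigr => n _; rewrite !fctE /D.
  change (- (1 / 2 * ((y n 0 - distances a t n 0) ^+ 2 / V n)) =
    - (2 * V n)^-1 * (y n 0 - distances a t n 0) ^+ 2).
  by field; rewrite V_neq0.
have dD n : is_derive X (delta_mx i 0) (D n) (J n i).
  apply: is_derive_eq (derive_distances _ (Xa n)) _.
  rewrite mxE (bigD1 i)//= [delta_mx _ _ _ _]mxE !eqxx mulr1 big1 ?addr0// => j ji.
  by rewrite [delta_mx _ _ _ _]mxE (negbTE ji) mulr0.
apply: derive_val; apply: is_derive_eq.
rewrite add0r; apply: eq_bigr => n _.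
rewrite !fctE /= expr1 sub0r.
change (- (2 * V n)^-1 * ((2 * (y n 0 - D n X)) * - J n i) =
  J n i / V n * (y n 0 - D n X)).
by field; rewrite V_neq0.
Qed.

(** The unsimplified right-hand side is the value in [mvn_second_moment] for the score coefficients
    [F n i / V n]. *)
Lemma information_entry (F : 'M[R]_(4, 3)) i j : (F^T *m invmx C *m F) i j =
  \sum_n V n * (F n i / V n) * (F n j / V n).
Proof.
rewrite invmx_diag// mul_mx_diag mxE; apply: eq_bigr => n _.
by rewrite !mxE; field; exact: V_neq0.
Qed.

Lemma information_sum : J^T *m invmx C *m J =
  \sum_n (1 / (V n * norm2 (displacement a X n) ^+ 2))
      *: (displacement a X n *m (displacement a X n)^T).
Proof.
apply/matrixP => i j; rewrite information_entry summxE; apply: eq_bigr => n _.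
rewrite !partials_distances// [RHS]mxE [in RHS]mxE big_ord1 [_^T _ _]mxE.
have d0 : norm2 (X - a n) != 0 by rewrite lt0r_neq0// norm2_gt0// subr_eq0.
by rewrite /displacement; field; rewrite V_neq0 d0.
Qed.

Context d (T : measurableType d) (Pr : probability T R) (e : T -> 'cV[R]_4).
Hypothesis He : mvn_distributed Pr e 0 C.
Local Notation dhat := (fun (t : 'cV[R]_3) (w : T) => distances a t + e w).

Lemma has_mean_score i j : has_mean Pr
  (fun w => score p X (dhat X w) i * score p X (dhat X w) j)
  ((J^T *m invmx C *m J) i j).
Proof.
have [mi mE] := mvn_second_moment V_gt0 He (fun n => J n i / V n) (fun n => J n j / V n).
rewrite information_entry; apply: eq_has_mean (conj mi mE) => w /=.
rewrite !score_distances; congr (_ * _); apply: eq_bigr => n _; congr (_ * _);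
  by rewrite mxE addrAC subrr add0r.
Qed.

Lemma fisher_information_distances :
  fisher_information Pr p (dhat X) X = J^T *m invmx C *m J.
Proof.
apply/matrixP => i j; rewrite mxE unlock.
by case: (has_mean_score i j) => _ ->.
Qed.

Let q (t : 'cV[R]_3) : R := \sum_n (distances a t n 0 - distances a X n 0) ^+ 2 / V n.
Let L (t : 'cV[R]_3) (w : T) : R :=
  likelihood_ratio V (distances a t - distances a X) (e w).

Let measurable_L c : measurable_fun [set: T] (fun w => likelihood_ratio V c (e w)).
Proof.
under eq_fun do rewrite -[e _]unvec4K.
by apply: (measurableT_comp (measurable_likelihood_ratio V c)); case: He.
Qed.

Let has_mean_likelihood_ratio c : has_mean Pr (fun w => likelihood_ratio V c (e w)) 1.
Proof.
apply: ge0_has_mean => //; first by move=> w; exact: expR_ge0.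
exact: integral_likelihood_ratio.
Qed.

(** The square of the ratio for a shift [c] is [expR (q t)] times the ratio for [2 *: c], which has
    mean 1. *)
Let has_mean_L2 t : has_mean Pr (fun w => L t w ^+ 2) (expR (q t)).
Proof.
have := has_meanZ (expR (q t))
  (has_mean_likelihood_ratio (2 *: (distances a t - distances a X))).
rewrite mulr1; apply: eq_has_mean => w.
rewrite /L /likelihood_ratio -expRM_natl -expRD; congr expR.
set c := distances a t - distances a X.
have -> : q t = \sum_i c i 0 ^+ 2 / V i by apply: eq_bigr => i _; rewrite !mxE.
have -> : \sum_i (2 *: c) i 0 * e w i 0 / V i = 2 * \sum_i c i 0 * e w i 0 / V i.
  by rewrite mulr_sumr; apply: eq_bigr => i _; rewrite [(2 *: c) i 0]mxE !mulrA.
have -> : \sum_i (2 *: c) i 0 ^+ 2 / V i = 4 * \sum_i c i 0 ^+ 2 / V i.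
  rewrite mulr_sumr; apply: eq_bigr => i _.
  by rewrite [(2 *: c) i 0]mxE; field; exact: V_neq0.
by field.
Qed.

Context (Theta : set 'cV[R]_3) (g : 'cV[R]_4 -> 'cV[R]_3).
Hypotheses (ThetaX : Theta X) (mg : measurable_estimator g)
  (ug : unbiased Pr Theta dhat g) (g2 : finite_second_moments Pr (fun w => g (dhat X w))).

Let G (u : 'I_3 -> R) (w : T) : R := \sum_i u i * (g (dhat X w) i 0 - X i 0).

Let has_mean_estimator t i : Theta t -> has_mean Pr (fun w => g (dhat t w) i 0) (t i 0).
Proof.
move=> /ug /(_ i) [/Lfun1_integrable gi]; rewrite unlock => gE; split; first exact: gi.
exact: gE.
Qed.

Let has_mean_G u : has_mean Pr (G u) 0.
Proof.
rewrite [X in has_mean _ _ X](_ : _ = \sum_i u i * (X i 0 - X i 0)); last first.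
  by rewrite big1// => i _; rewrite subrr mulr0.
apply: has_mean_sum => i; apply: has_meanZ.
apply: has_meanB; last exact: has_mean_cst.
exact: has_mean_estimator.
Qed.

(** Weighting by [L t] moves the observation from [X] to [t] by Cameron-Martin, and there
    unbiasedness gives the mean. The function [h] is [G u] expressed in terms of the noise. *)
Let has_mean_GL u t : Theta t ->
  has_mean Pr (fun w => G u w * L t w) (\sum_i u i * (t i 0 - X i 0)).
Proof.
move=> tT.
pose h (y : @space4 R) := \sum_i u i * (g (distances a X + vec4 y) i 0 - X i 0).
have mh : measurable_fun [set: @space4 R] h.
  apply: measurable_sum => i; apply: measurable_funM => //.
  apply: measurable_funB => //.
  rewrite (_ : (fun y => _) = (fun y => g (vec4 y) i 0) \o shift4 (distances a X)).
    exact: measurableT_comp (mg i) (measurable_shift4 _).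
  by apply/funext => y /=; rewrite shift4E unvec4K.
have hE c w : h (unvec4 (c + e w)) =
    \sum_i u i * (g (distances a X + (c + e w)) i 0 - X i 0).
  by rewrite /h unvec4K.
have [hi hm] : has_mean Pr (fun w => h (unvec4 (distances a t - distances a X + e w)))
    (\sum_i u i * (t i 0 - X i 0)).
  apply: (@eq_has_mean _ _ _ _ (fun w => \sum_i u i * (g (dhat t w) i 0 - X i 0))).
    by move=> w; rewrite hE addrA subrKC.
  apply: has_mean_sum => i; apply: has_meanZ.
  by apply: has_meanB; [exact: has_mean_estimator|exact: has_mean_cst].
have [hLi hLE] := cameron_martin V_gt0 He mh hi.
split.
  move: hLi; congr (Pr.-integrable _ _); apply/funext => w /=.
  by rewrite /h unvec4K.
rewrite -hm hLE; apply: eq_integral => w _.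
by rewrite /h unvec4K.
Qed.

(** Unbiasedness at [X] makes the centring in the covariance equal to [X]. Integrability comes from
    expanding the product and using that a product of two L^2 functions is in L^1. *)
Let has_mean_GG i j : has_mean Pr
  (fun w => (g (dhat X w) i 0 - X i 0) * (g (dhat X w) j 0 - X j 0))
  (covariance_matrix Pr (fun w => g (dhat X w)) i j).
Proof.
have [_ Ei] := has_mean_estimator i ThetaX; have [_ Ej] := has_mean_estimator j ThetaX.
rewrite mxE unlock /= unlock Ei Ej /=.
apply: has_mean_fine.
have := Lfun2_mul_Lfun1 (g2 i) (g2 j) => /Lfun1_integrable gij.
have [+ _] := has_meanD (has_meanB (has_meanB (has_mean_fine gij)
  (has_meanZ (X j 0) (has_mean_estimator i ThetaX)))
  (has_meanZ (X i 0) (has_mean_estimator j ThetaX))) (has_mean_cst Pr (X i 0 * X j 0)).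
congr (Pr.-integrable _ _); apply/funext => w /=.
by congr EFin; ring.
Qed.

Let has_mean_G2 (u : 'cV[R]_3) : has_mean Pr (fun w => G (fun i => u i 0) w ^+ 2)
  ((u^T *m covariance_matrix Pr (fun w => g (dhat X w)) *m u) 0 0).
Proof.
rewrite mxE.
apply: (@eq_has_mean _ _ _ _ (fun w => \sum_j \sum_i u j 0 * (u i 0 *
  ((g (dhat X w) i 0 - X i 0) * (g (dhat X w) j 0 - X j 0))))).
  move=> w; rewrite expr2 [in RHS]/G mulr_sumr; apply: eq_bigr => j _.
  rewrite /G mulr_suml; apply: eq_bigr => i _; ring.
apply: has_mean_sum => j; rewrite mxE mulr_suml.
apply: has_mean_sum => i; rewrite mxE mulrC; apply: has_meanZ; exact: has_meanZ.
Qed.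

Lemma chapman_robbins (u : 'cV[R]_3) t k : Theta t ->
  2 * k * (\sum_i u i 0 * (t i 0 - X i 0)) - k ^+ 2 * (expR (q t) - 1) <=
  (u^T *m covariance_matrix Pr (fun w => g (dhat X w)) *m u) 0 0.
Proof.
move=> tT; set c := _ 0 0; set s := \sum_i _.
pose u' i := u i 0.
(* Term by term the mean of (G - k (L - 1))^2; the term in [G] alone has mean 0 but completes the
   pointwise square. *)
have h := has_meanD (has_meanD (has_meanB (has_mean_G2 u)
    (has_meanZ (2 * k) (has_mean_GL u' tT)))
  (has_meanZ (2 * k) (has_mean_G u')))
  (has_meanZ (k ^+ 2) (has_meanD (has_meanB (has_mean_L2 t)
    (has_meanZ 2 (has_mean_likelihood_ratio (distances a t - distances a X))))
    (has_mean_cst Pr 1))).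
have H := fun h0 => has_mean_ge0 h0 h.
rewrite -/c -/s in H; rewrite -subr_ge0.
suff -> : c - (2 * k * s - k ^+ 2 * (expR (q t) - 1)) =
  c - 2 * k * s + 2 * k * 0 + k ^+ 2 * (expR (q t) - 2 * 1 + 1).
  apply: H => w; rewrite -/(L t w).
  have sq (x y : R) :
    x ^+ 2 - 2 * k * (x * y) + 2 * k * x + k ^+ 2 * (y ^+ 2 - 2 * y + 1) =
    (x - k * (y - 1)) ^+ 2 by ring.
  by have := sqr_ge0 (G u' w - k * (L t w - 1)); rewrite -sq.
ring.
Qed.

Let q_quotient (v : 'cV[R]_3) (h : R) : R :=
  \sum_n (h^-1 * (distances a (h *: v + X) n 0 - distances a X n 0)) ^+ 2 / V n.

(** Each difference quotient tends to the directional derivative [(J *m v) n 0], and the weighted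
    sum of the squares of these is the Fisher quadratic form. *)
Let cvg_q_quotient v :
  q_quotient v h @[h --> 0^'] --> (v^T *m (J^T *m invmx C *m J) *m v) 0 0.
Proof.
have -> : (v^T *m (J^T *m invmx C *m J) *m v) 0 0 =
    \sum_n ((J *m v) n 0) ^+ 2 / V n.
  by rewrite -!mulmxA mulmxA -trmx_mul mulmxA quad_invmx_diag.
have cvgn n : h^-1 * (distances a (h *: v + X) n 0 - distances a X n 0) @[h --> 0^']
    --> (J *m v) n 0.
  have dn := derive_distances v (Xa n).
  by rewrite -(@derive_val _ _ _ _ _ _ _ dn); exact: ex_derive.
rewrite /q_quotient; apply: cvg_big => [|n _]; first exact: add_continuous.
apply: cvgMl.
by rewrite expr2; under eq_fun do rewrite expr2; exact: cvgM.
Qed.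

Let q_line v h : h != 0 -> q (h *: v + X) = h ^+ 2 * q_quotient v h.
Proof.
move=> h0; rewrite mulr_sumr; apply: eq_bigr => n _; field.
by rewrite h0 V_neq0.
Qed.

Lemma cramer_rao (u v : 'cV[R]_3) : open Theta ->
  2 * (u^T *m v) 0 0 - (v^T *m (J^T *m invmx C *m J) *m v) 0 0 <=
  (u^T *m covariance_matrix Pr (fun w => g (dhat X w)) *m u) 0 0.
Proof.
move=> oT.
have lim : (2 * (u^T *m v) 0 0 - q_quotient v h * expR (h ^+ 2 * q_quotient v h))
    @[h --> 0^'] --> 2 * (u^T *m v) 0 0 - (v^T *m (J^T *m invmx C *m J) *m v) 0 0.
  apply: cvgB; first exact: cvg_cst.
  rewrite -[X in _ --> X]mulr1; apply: cvgM; first exact: cvg_q_quotient.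
  rewrite -(@expR0 R); apply: continuous_cvg; first exact: continuous_expR.
  rewrite -[X in _ --> X](mul0r ((v^T *m (J^T *m invmx C *m J) *m v) 0 0)).
  apply: cvgM; last exact: cvg_q_quotient.
  have h0 : h @[h --> (0 : R)^'] --> (0 : R) by exact: nbhs_dnbhs.
  by have := cvgM h0 h0; rewrite mulr0 => h2; exact: h2.
apply: (cvgr_to_le lim).
(* Openness of [Theta] keeps the nearby parameters admissible, so unbiasedness applies to them. *)
have nT : \forall h \near 0^', Theta (h *: v + X).
  apply: nbhs_dnbhs.
  have cT : (h *: v + X) @[h --> (0 : R)] --> X.
    rewrite -[X in _ --> X]add0r -(scale0r v); apply: cvgD; last exact: cvg_cst.
    by apply: cvgZl; exact: cvg_id.
  exact: cT (open_nbhs_nbhs (conj oT ThetaX)).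
near=> h.
have h0 : h != 0 by near: h; exact: nbhs_dnbhs_neq.
have hT : Theta (h *: v + X) by near: h.
apply: le_trans (chapman_robbins u h^-1 hT).
have -> : \sum_i u i 0 * ((h *: v + X) i 0 - X i 0) = h * (u^T *m v) 0 0.
  by rewrite mxE mulr_sumr; apply: eq_bigr => i _; rewrite !mxE; ring.
rewrite (q_line _ h0); set Q := q_quotient v h; set x := h ^+ 2 * Q.
(* This replaces (exp x - 1) / x by exp x without dividing by [x], which vanishes when [Q] does. *)
have ex : expR x - 1 <= x * expR x.
  have := ler_wpM2l (expR_ge0 x) (expR_ge1Dx (- x)).
  by rewrite -expRD subrr expR0; lra.
have := ler_wpM2l (sqr_ge0 h^-1) ex.
rewrite (_ : h^-1 ^+ 2 * (x * expR x) = Q * expR x); last by rewrite /x; field.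
have -> : 2 * h^-1 * (h * (u^T *m v) 0 0) = 2 * (u^T *m v) 0 0 by field.
by move=> ?; rewrite lerD2l lerN2.
Unshelve. all: by end_near. Qed.

(** At v = F^-1 u the two terms of the lower bound in [cramer_rao] become 2 u^T F^-1 u and u^T F^-1
    u. *)
Lemma cramer_rao_loewner : open Theta -> J^T *m invmx C *m J \in unitmx ->
  loewner_le (invmx (J^T *m invmx C *m J))
    (covariance_matrix Pr (fun w => g (dhat X w))).
Proof.
move=> oT; set F := J^T *m _ *m J => uF u.
have := @cramer_rao u (invmx F *m u) oT; rewrite -/F; apply: le_trans.
have dotC (x y : 'cV[R]_3) : (x^T *m y) 0 0 = (y^T *m x) 0 0.
  by rewrite !mxE; apply: eq_bigr => i _; rewrite !mxE mulrC.
have -> : ((invmx F *m u)^T *m F *m (invmx F *m u)) 0 0 = (u^T *m (invmx F *m u)) 0 0.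
  by rewrite -mulmxA mulKVmx// dotC.
rewrite -mulmxA; lra.
Qed.

(** For an unbiased estimator the mean squared error is the trace of the covariance matrix, and
    testing the Loewner inequality on basis vectors compares the diagonals. *)
Lemma position_error_bound_le_rmse : open Theta -> J^T *m invmx C *m J \in unitmx ->
  position_error_bound (J^T *m invmx C *m J) <=
  rmse Pr (fun w => g (dhat X w)) X.
Proof.
move=> oT uF; have LE := cramer_rao_loewner oT uF.
apply: ler_wsqrtr.
have [_ E] : has_mean Pr (fun w => norm2 (g (dhat X w) - X) ^+ 2)
    (\tr (covariance_matrix Pr (fun w => g (dhat X w)))).
  apply: eq_has_mean (has_mean_sum _ (fun i => has_mean_GG i i)) => w.
  by rewrite norm2_sqr; apply: eq_bigr => i _; rewrite !mxE expr2.
rewrite expectation.unlock E /=; apply: ler_sum => i _.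
have diagE (M : 'M[R]_3) : ((delta_mx i 0 : 'cV[R]_3)^T *m M *m delta_mx i 0) 0 0 = M i i.
  rewrite mxE (bigD1 i)//= big1 => [|k ki]; last first.
    by rewrite [delta_mx _ _ _ _]mxE (negbTE ki) mulr0.
  rewrite [delta_mx _ _ _ _]mxE !eqxx mulr1 addr0 mxE (bigD1 i)//= big1 => [|k ki].
    by rewrite !mxE !eqxx mul1r addr0.
  by rewrite !mxE (negbTE ki) mul0r.
by have := LE (delta_mx i 0); rewrite !diagE.
Qed.

End localization.

(** * Likelihood, Fisher information and position error bound for both ranging algorithms *)

Theorem mainTheorem3 (R : realType) (s : system R) (A : algorithm)
  (a : 'I_4 -> 'cV[R]_3) (X : 'cV[R]_3)
  (d : measure_display) (T : measurableType d) (Pr : probability T R)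
  (e : T -> 'cV[R]_4)
  (Hphys : physical s) (Hadm : admissible A s)
  (Hdist : forall n, X != a n)
  (He : mvn_distributed Pr e 0 (ranging_covariance A s a X)) :
  let C := ranging_covariance A s a X in
  let dhat := fun (t : 'cV[R]_3) (w : T) => distances a t + e w in
  let p := fun (t : 'cV[R]_3) (y : 'cV[R]_4) => mvn_pdf (distances a t) C y in
  let FIM := fisher_information Pr p (dhat X) X in
  let J := partials (distances a) X in
  let info := \sum_(n < 4)
    (1 / (ranging_variance A s a X n * norm2 (displacement a X n) ^+ 2))
      *: (displacement a X n *m (displacement a X n)^T) in
  [/\ (forall t, has_density Pr (dhat t) (p t)) /\
      (exists const : R, forall t y,
         ln (p t y) = const -
           1 / 2 * ((y - distances a t)^T *m invmx C *m (y - distances a t)) 0 0),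
      (forall i j, Pr.-integrable [set: T]
         (fun w => (score p X (dhat X w) i * score p X (dhat X w) j)%:E)),
      FIM = J^T *m invmx C *m J /\ FIM = info
    & FIM \in unitmx ->
      position_error_bound FIM = Num.sqrt (\tr (invmx info)) /\
      (forall (Theta : set 'cV[R]_3) (g : 'cV[R]_4 -> 'cV[R]_3),
         open Theta -> Theta X ->
         measurable_estimator g -> unbiased Pr Theta dhat g ->
         finite_second_moments Pr (fun w => g (dhat X w)) ->
         loewner_le (invmx FIM) (covariance_matrix Pr (fun w => g (dhat X w))) /\
         position_error_bound FIM <= rmse Pr (fun w => g (dhat X w)) X)].
Proof.
move=> C dhat p FIM J info.
have V_gt0 n : 0 < ranging_variance A s a X n by exact: ranging_variance_gt0.
have V_neq0 n : ranging_variance A s a X n != 0 by exact: lt0r_neq0.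
have FJ : FIM = J^T *m invmx C *m J by exact: fisher_information_distances.
have FI : FIM = info by rewrite FJ; exact: information_sum.
split.
- split=> [t|]; first exact: has_density_translate_mvn.
  (* The logarithm of the Gaussian normalization, which is free of [t] because the variances are
     frozen at [X]. *)
  exists (ln (Num.sqrt ((2 * pi) ^+ 4 * \prod_i ranging_variance A s a X i))^-1).
  move=> t y; rewrite /p ln_mvn_pdf_diag// quad_invmx_diag//.
  by congr (_ - _ * _); apply: eq_bigr => i _; rewrite !mxE expr2.
- by move=> i j; case: (has_mean_score V_gt0 Hdist He i j).
- by split.
move=> uF; split; first by rewrite FI.
move=> Theta g oT TX mg ug g2; rewrite FJ in uF *; split.
- exact: (cramer_rao_loewner V_gt0 Hdist He TX mg ug g2 oT uF).
- exact: (position_error_bound_le_rmse V_gt0 Hdist He TX mg ug g2 oT uF).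
Qed.
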